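(* Let $\kappa$ be an infinite cardinal. (1) If $\mathbf\Delta_\kappa(\mathbb Z)$ is projective in the category $(\kappa.g.\text{-}\mathsf{Ab})^{\kappa^{\mathrm{op}}}$, then $\kappa$ has the tree property. (2) If $\kappa$ has the tree property, then $\mathbf\Delta_\kappa(\mathbb Z)$ is projective in $(\kappa\text{-}\mathsf{Ab})^{\kappa^{\mathrm{op}}}$. In particular, an uncountable cardinal $\kappa$ has the tree property if and only if $\mathbf\Delta_\kappa(\mathbb Z)$ is projective in $(\kappa\text{-}\mathsf{Ab})^{\kappa^{\mathrm{op}}}$.
   Context: $\kappa\text{-}\mathsf{Ab}$ is the category of abelian groups of cardinality $<\kappa$; $\kappa.g.\text{-}\mathsf{Ab}$ is the category of abelian groups having a generating set of cardinality $<\kappa$. For a category $\mathcal C$, $\mathcal C^{\kappa^{\mathrm{op}}}$ is the category of inverse systems in $\mathcal C$ indexed by the ordinal $\kappa$: objects are $(X_\xi,x_{\eta\xi},\kappa)$ with objects $X_\xi$ and morphisms $x_{\eta\xi}:X_\xi\to X_\eta$ ($\eta\le\xi<\kappa$) satisfying $x_{\eta\zeta}=x_{\eta\xi}x_{\xi\zeta}$ (and $x_{\xi\xi}=\mathrm{id}$); morphisms are families $\{f_\xi\}$ commuting with bonding maps. $\mathbf\Delta_\kappa(\mathbb Z)=(\mathbb Z,\mathrm{id},\kappa)$. An object $\mathbf P$ is projective if every epimorphism $\mathbf e:\mathbf R\to\mathbf P$ in the category admits $\mathbf s:\mathbf P\to\mathbf R$ with $\mathbf e\mathbf s=\mathrm{id}$.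 A $\kappa$-tree is a tree of height $\kappa$ all of whose levels have cardinality $<\kappa$; it is Aronszajn if it has no cofinal branch; $\kappa$ has the tree property if there are no $\kappa$-Aronszajn trees. *)

(* Defs.v *)
From HB Require Import structures.
From mathcomp Require Import all_boot all_order all_algebra.
From mathcomp Require Import boolp classical_sets functions cardinality.
Set Implicit Arguments.
Unset Strict Implicit.
Unset Printing Implicit Defensive.
Import Order.TTheory GRing.Theory.
Local Open Scope classical_set_scope.
Local Open Scope card_scope.

Definition card_lt (T U : Type) (A : set T) (B : set U) : Prop :=
  (A #<= B) /\ ~ (B #<= A).

(* Taking S to be a pair of elements shows that A is totally ordered. *)
Definition well_ordered (d : Order.disp_t) (T : porderType d) (A : set T) :=
  forall S : set T, S `<=` A -> S !=set0 ->
    exists2 m, S m & forall y, S y -> (m <= y)%O.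

(* Cardinals are initial ordinals: kappa is given as a well-ordered type, its
   elements being the ordinals below kappa, all of whose proper initial
   segments have smaller cardinality. *)
Definition infinite_cardinal (d : Order.disp_t) (K : orderType d) :=
  [/\ well_ordered [set: K], infinite_set [set: K]
    & forall a : K, card_lt [set b : K | (b < a)%O] [set: K]].

Section Trees.
Context (d : Order.disp_t) (K : orderType d).
Context (d' : Order.disp_t) (T : porderType d').

Definition is_tree := forall x : T, well_ordered [set y : T | (y < x)%O].

(* The order type of the set of predecessors of x is the ordinal a. *)
Definition has_height (x : T) (a : K) :=
  exists2 f : T -> K,
    set_bij [set y : T | (y < x)%O] [set b : K | (b < a)%O] f
    & forall y z : T, (y < x)%O -> (z < x)%O -> (f y < f z)%O = (y < z)%O.

Definition level (a : K) : set T := [set x | has_height x a].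

Definition height_is_kappa :=
  (forall x : T, exists a : K, level a x) /\ (forall a : K, level a !=set0).

Definition kappa_tree :=
  [/\ is_tree, height_is_kappa
    & forall a : K, card_lt (level a) [set: K]].

Definition chain (b : set T) := forall x y : T, b x -> b y -> (x >=< y)%O.

Definition branch (b : set T) :=
  chain b /\ forall c : set T, chain c -> b `<=` c -> c = b.

Definition cofinal_branch (b : set T) :=
  branch b /\ forall a : K, b `&` level a !=set0.

Definition aronszajn := kappa_tree /\ ~ exists b : set T, cofinal_branch b.

End Trees.

Definition tree_property (d : Order.disp_t) (K : orderType d) :=
  forall (d' : Order.disp_t) (T : porderType d'), ~ aronszajn K T.

Definition kappaAb (K : Type) (G : zmodType) : Prop := card_lt [set: G] [set: K].

Definition subgroup (G : zmodType) (H : set G) :=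
  H 0%R /\ forall x y : G, H x -> H y -> H (x - y)%R.

Definition kappagAb (K : Type) (G : zmodType) : Prop :=
  exists2 S : set G, card_lt S [set: K] & smallest (@subgroup G) S = [set: G].

Section InverseSystems.
Context (d : Order.disp_t) (K : orderType d).

Record inv_system := InvSystem {
  obj :> K -> zmodType;
  bond : forall eta xi : K, (eta <= xi)%O -> {additive obj xi -> obj eta};
  bond_id : forall (xi : K) (h : (xi <= xi)%O) (x : obj xi), bond h x = x;
  bond_comp : forall (eta xi zeta : K) (h1 : (eta <= xi)%O)
    (h2 : (xi <= zeta)%O) (h3 : (eta <= zeta)%O) (x : obj zeta),
    bond h3 x = bond h1 (bond h2 x) }.

Record inv_mor (X Y : inv_system) := InvMor {
  mor :> forall xi : K, {additive X xi -> Y xi};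
  mor_bond : forall (eta xi : K) (h : (eta <= xi)%O) (x : X xi),
    mor eta (bond X h x) = bond Y h (mor xi x) }.

(* C : zmodType -> Prop stands for the full subcategory of abelian groups with
   objects the G such that C G, and in_system_cat C X says that X is an object
   of the category of inverse systems in C indexed by kappa. *)
Definition in_system_cat (C : zmodType -> Prop) (X : inv_system) :=
  forall xi : K, C (X xi).

Definition epi_in (C : zmodType -> Prop) (X Y : inv_system) (e : inv_mor X Y) :=
  forall (Z : inv_system), in_system_cat C Z -> forall g h : inv_mor Y Z,
    (forall (xi : K) (x : X xi), g xi (e xi x) = h xi (e xi x)) ->
    forall (xi : K) (y : Y xi), g xi y = h xi y.

(* P is meant to be an object of the category; see Delta_kappagAb and
   Delta_kappaAb below. Membership is not part of the definition because the
   constant system on the integers is not in the category for kappaAb when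
   kappa is countable. *)
Definition projective_in (C : zmodType -> Prop) (P : inv_system) :=
  forall R : inv_system, in_system_cat C R ->
    forall e : inv_mor R P, epi_in C e ->
      exists s : inv_mor P R, forall (xi : K) (y : P xi), e xi (s xi y) = y.

Definition Delta (G : zmodType) : inv_system :=
  @InvSystem (fun=> G) (fun _ _ _ => idfun)
    (fun _ _ _ => erefl) (fun _ _ _ _ _ _ _ => erefl).

Lemma Delta_kappagAb : infinite_cardinal K ->
  in_system_cat (kappagAb K) (Delta int).
Proof.
case=> _ infK _ xi; exists [set 1%R].
  split; first by apply: card_le_trans (proj1 (infiniteP _) infK);
    apply: finite_set_countable; exact: finite_set1.
  by move=> le; apply: infK; exact: card_le_finite le (finite_set1 _).
apply/seteqP; split=> // n _ H [[H0 HB] H1].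
have H1' : H 1%R by exact: H1.
have HN x : H x -> H (- x)%R by move=> Hx; rewrite -[(- x)%R]add0r; exact: HB.
have HD x y : H x -> H y -> H (x + y)%R.
  by move=> Hx Hy; rewrite -[y]opprK; apply: HB => //; exact: HN.
by elim: n => [|n IH|n IH]; rewrite ?intS ?opprD; auto.
Qed.

Lemma Delta_kappaAb : ~ countable [set: K] ->
  in_system_cat (kappaAb K) (Delta int).
Proof.
move=> ncK xi; split; last first.
  by move=> le; apply: ncK; apply: card_le_trans le _; exact: countableP.
have infK : infinite_set [set: K] by move=> /finite_set_countable.
by apply: card_le_trans (proj1 (infiniteP _) infK); exact: countableP.
Qed.

End InverseSystems.

(* Main.v *)
(* Every inverse system of nonempty sets of size < kappa indexed by kappa has a
   thread if and only if kappa has the tree property: threads are cofinal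
   branches of the disjoint union of the sets of the system, and conversely the
   levels of a kappa-tree form such a system.

   If kappa has the tree property, then a thread in the system of fibres
   e_xi^-1(1) is the image of 1 under a section of e.

   If Delta_kappa(Z) is projective and X is a system of sets, then the free
   abelian groups on the X_xi map onto Delta_kappa(Z) by the degree. The
   supports S_xi of the values at 1 of a section are finite and nonempty, and
   S_eta is contained in the image of S_xi. If their sizes are bounded, then
   they are eventually mapped into each other, and a limit along an ultrafilter
   gives a thread. Otherwise kappa has a countable cofinal sequence a. If kappa
   is countable, then the X_xi are finite, and the same limit works. If not,
   then the system of the sets {n | xi <= a n} with the inclusions has no
   family of supports, since their intersection is empty. *)
Require Import Defs.
From HB Require Import structures.
From mathcomp Require Import all_boot all_order all_algebra.
From mathcomp Require Import boolp classical_sets functions cardinality filter.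
From mathcomp Require Import freeg.
Set Implicit Arguments.
Unset Strict Implicit.
Unset Printing Implicit Defensive.
Import Order.TTheory GRing.Theory.
Local Open Scope classical_set_scope.
Local Open Scope card_scope.

(** * Cardinality of generated groups *)

(** A maximal graph of a partial injection from [A] to [B], given by Zorn's lemma, is total on one
    of the two sides. *)
Lemma injfun_total (X : Type) (A B : set X) :
  exists f : X -> X, (set_fun A B f /\ set_inj A f) \/
                     (set_fun B A f /\ set_inj B f).
Proof.
pose P (G : set (X * X)) :=
  [/\ forall x y, G (x, y) -> A x /\ B y,
      forall x y y', G (x, y) -> G (x, y') -> y = y'
    & forall x x' y, G (x, y) -> G (x', y) -> x = x'].
have [F FP totF|G [[GAB Gfun Ginj] Gmax]] := @Zorn_bigcup _ P.
  have pairF u v : (\bigcup_(H in F) H) u -> (\bigcup_(H in F) H) v ->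
      exists H, [/\ F H, H u & H v].
    move=> [H FH Hu] [H' FH' Hv]; have [s|s] := totF _ _ FH FH'.
      by exists H'; split=> //; exact: s.
    by exists H; split=> //; exact: s.
  split.
  - by move=> x y [H /FP[h _ _]]; exact: h.
  - by move=> x y y' u v; have [H [/FP[_ h _]]] := pairF _ _ u v; exact: h.
  - by move=> x x' y u v; have [H [/FP[_ _ h]]] := pairF _ _ u v; exact: h.
have [totA|/existsNP[x0 /not_implyP[Ax0 /forallNP nx0]]] :=
    pselect (forall x, A x -> exists y, G (x, y)).
  have /choice[f fP] x : exists y, A x -> G (x, y).
    by have [/totA[y Gxy]|nA] := pselect (A x); [exists y|exists x].
  exists f; left; split=> [x /fP/GAB[]//|x x'].
  move=> /set_mem Ax /set_mem Ax' e.
  by apply: (Ginj x x' (f x)); [exact: fP|rewrite e; exact: fP].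
have [totB|/existsNP[y0 /not_implyP[By0 /forallNP ny0]]] :=
    pselect (forall y, B y -> exists x, G (x, y)).
  have /choice[f fP] y : exists x, B y -> G (x, y).
    by have [/totB[x Gxy]|nA] := pselect (B y); [exists x|exists y].
  exists f; right; split=> [x /fP/GAB[]//|x x'].
  move=> /set_mem Ax /set_mem Ax' e.
  by apply: (Gfun (f x)); [exact: fP|rewrite e; exact: fP].
exfalso; apply: (Gmax (G `|` [set (x0, y0)])); last split.
- split=> [z|]; first by left.
  by move=> /(_ (x0, y0) (or_intror erefl)); exact: nx0.
- by move=> x y [/GAB//|[-> ->]].
- move=> x y y' [h|[ex ey]] [h'|[ex' ey']]; first exact: Gfun h h'.
  + by case: (nx0 y); rewrite -ex'.
  + by case: (nx0 y'); rewrite -ex.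
  + by rewrite ey ey'.
- move=> x x' y [h|[ex ey]] [h'|[ex' ey']]; first exact: Ginj h h'.
  + by case: (ny0 x); rewrite -ey'.
  + by case: (ny0 x'); rewrite -ey.
  + by rewrite ex ex'.
Qed.

(* Zorn's lemma is applied to the graphs of injections into A from the
   nonempty words on A. If A is not equipotent to X, then it has a disjoint
   copy B in X, and the words on A `|` B that are not words on A can be
   mapped injectively to B. *)
Lemma inj_seq_infinite (X : choiceType) (n : nat -> X) :
  injective n -> exists f : seq X -> X, injective f.
Proof.
move=> ninj.
(* The alphabet is read off the graph, as the letters whose one-letter words have values, so that
   Zorn's lemma deals with graphs alone. *)
pose alph (G : set (seq X * X)) : set X := [set x | exists y, G ([:: x], y)].
pose word (A : set X) (s : seq X) := s <> [::] /\ forall x, x \in s -> A x.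
pose P (G : set (seq X * X)) :=
  [/\ forall s y, G (s, y) -> word (alph G) s /\ alph G y,
      forall s y y', G (s, y) -> G (s, y') -> y = y',
      forall s s' y, G (s, y) -> G (s', y) -> s = s'
    & forall s, word (alph G) s -> exists y, G (s, y)].
have [F FP totF|G [[Gw Gfun Ginj Gtot] Gmax]] := @Zorn_bigcup _ P.
  set U := \bigcup_(H in F) H.
  have pairF u v : U u -> U v -> exists H, [/\ F H, H u & H v].
    move=> [H FH Hu] [H' FH' Hv]; have [s|s] := totF _ _ FH FH'.
      by exists H'; split=> //; exact: s.
    by exists H; split=> //; exact: s.
  have alphS H : F H -> alph H `<=` alph U.
    by move=> FH x [y Hxy]; exists y, H.
  split.
  - move=> s y [H FH Hsy]; have [h _ _ _] := FP _ FH.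
    have [[s0 ws] yH] := h _ _ Hsy.
    by split; [split=> // x /ws; exact: alphS|exact: alphS yH].
  - by move=> x y y' u v; have [H [/FP[_ h _ _]]] := pairF _ _ u v; exact: h.
  - by move=> x x' y u v; have [H [/FP[_ _ h _]]] := pairF _ _ u v; exact: h.
  - move=> s [s0 ws].
    (* The finitely many letters of a word already occur in one member of the chain. *)
    suff [H FH Hs] : exists2 H, F H & forall x, x \in s -> alph H x.
      have [_ _ _ h] := FP _ FH.
      by have [|y Hy] := h s; [split|exists y, H].
    case: s s0 ws => // x s _; elim: s x => [|z s IH] x ws.
      have [y [H FH Hxy]] := ws x (mem_head _ _).
      by exists H => // t; rewrite inE => /eqP ->; exists y.
    have [|H FH Hs] := IH z.
      by move=> t ts; apply: ws; rewrite inE ts orbT.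
    have [y [H' FH' Hxy]] := ws x (mem_head _ _).
    have [ss|ss] := totF _ _ FH FH'.
      exists H' => // t; rewrite inE => /orP[/eqP ->|/Hs[w /ss]].
        by exists y.
      by exists w.
    exists H => // t; rewrite inE => /orP[/eqP ->|/Hs//].
    by exists y; exact: ss.
set A := alph G.
(* Maximality of [G]: the values of [g] on the new words would extend [G] to the union of [A] and
   [B]. *)
have noext (B : set X) (g : seq X -> X) : (forall x, A x -> ~ B x) ->
    B !=set0 -> (forall s, word (A `|` B) s -> B (g s)) ->
    (forall s s', word (A `|` B) s -> word (A `|` B) s' -> g s = g s' ->
     s = s') -> False.
  move=> AB [b0 Bb0] gB ginj.
  pose G' : set (seq X * X) :=
    G `|` [set u | [/\ word (A `|` B) u.1, ~ word A u.1 & u.2 = g u.1]].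
  have w1 (C : set X) x : C x -> word C [:: x].
    by move=> Cx; split=> // y; rewrite inE => /eqP ->.
  have alphG' : alph G' = A `|` B.
    apply/seteqP; split=> x.
      case=> y [Gxy|[[_ /= w] _ _]]; first by left; exists y.
      by apply: w; rewrite inE.
    case=> [[y Gxy]|Bx]; first by exists y; left.
    exists (g [:: x]); right; split=> //=; first by apply: w1; right.
    by case=> _ /(_ x (mem_head _ _)) /AB.
  apply: (Gmax G'); first split.
  - by move=> u; left.
  - move=> /(_ ([:: b0], g [:: b0])) h.
    have [|_ hA] := Gw [:: b0] (g [:: b0]).
      apply: h; right; split=> //=; first by apply: w1; right.
      by case=> _ /(_ b0 (mem_head _ _)) /AB.
    by apply: AB hA _; apply: gB; apply: w1; right.
  - rewrite /P alphG'; split.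
    + move=> s y [/Gw[[s0 ws] Ay]|[/= ws _ ->]].
        by split; [split=> // x /ws|]; left.
      by split=> //; right; exact: gB.
    + move=> s y y' [h|[/= ws nws ->]] [h'|[/= ws' nws' ->]] //.
      * exact: Gfun h h'.
      * by have [] := Gw _ _ h.
      * by have [] := Gw _ _ h'.
    + move=> s s' y [h|[/= ws nws e]] [h'|[/= ws' nws' e']].
      * exact: Ginj h h'.
      * have [_ Ay] := Gw _ _ h; case: (AB y) => //.
        by rewrite e'; exact: gB.
      * have [_ Ay] := Gw _ _ h'; case: (AB y) => //.
        by rewrite e; exact: gB.
      * by apply: ginj => //; rewrite -e -e'.
    + move=> s ws; have [wA|nwA] := pselect (word A s).
        by have [y Gsy] := Gtot _ wA; exists y; left.
      by exists (g s); right.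
(* If [A] is empty, then [pickle] numbers the words on the countable set [range n], against
   [noext]. *)
have [A0|/existsNP[a0 /contrapT Aa0]] := pselect (forall x, ~ A x).
  have /choice[i iP] x : exists k, range n x -> n k = x.
    have [[k _ <-]|nx] := pselect (range n x); first by exists k.
    by exists 0.
  exfalso; apply: (noext (range n) (fun s => n (pickle (map i s)))).
  - by move=> x /A0.
  - by exists (n 0); exists 0.
  - by move=> s _; exists (pickle (map i s)).
  - move=> s s' [_ ws] [_ ws'] /ninj /(pcan_inj pickleK).
    have wr t (wt : forall x, x \in t -> (A `|` range n) x) :
        map n (map i t) = t.
      rewrite -map_comp -[RHS]map_id; apply/eq_in_map => x /wt [/A0//|] /=.
      exact: iP.
    by move=> /(congr1 (map n)); rewrite !wr.
have /choice[phi phiP] s : exists y, word A s -> G (s, y).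
  by have [/Gtot[y]|nw] := pselect (word A s); [exists y|exists a0].
have phiA s : word A s -> A (phi s) by move=> /phiP /Gw[].
have phi_inj s s' : word A s -> word A s' -> phi s = phi s' -> s = s'.
  by move=> ws ws' e; apply: (Ginj _ _ (phi s)); [|rewrite e]; exact: phiP.
have w1 x : A x -> word A [:: x].
  by move=> Ax; split=> // y; rewrite inE => /eqP ->.
have w2 x : A x -> word A [:: x; x].
  by move=> Ax; split=> // y; rewrite !inE => /orP[] /eqP ->.
(* Letters of [A] are coded through one-letter words and those of [B] through two-letter words;
   injectivity of [phi] keeps the two kinds apart. *)
have code (B : set X) (c : X -> X) : (forall x, B x -> A (c x)) ->
    (forall x y, B x -> B y -> c x = c y -> x = y) ->
    exists k : X -> X, (forall x, (A `|` B) x -> A (k x)) /\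
      (forall x y, (A `|` B) x -> (A `|` B) y -> k x = k y -> x = y).
  move=> cA cinj.
  exists (fun x => if pselect (A x) then phi [:: x] else phi [:: c x; c x]).
  split=> [x|x y].
    case: pselect => [/w1/phiA//|nA [//|/cA/w2/phiA//]].
  case: pselect => [Ax _|nAx [//|Bx]]; case: pselect => [Ay _|nAy [//|By]].
  - by move=> /(phi_inj _ _ (w1 _ Ax) (w1 _ Ay)) [].
  - by move=> /(phi_inj _ _ (w1 _ Ax) (w2 _ (cA _ By))).
  - by move=> /(phi_inj _ _ (w2 _ (cA _ Bx)) (w1 _ Ay)).
  - by move=> /(phi_inj _ _ (w2 _ (cA _ Bx)) (w2 _ (cA _ By))) [/cinj ->].
have inj_map (B : set X) (k : X -> X) s t :
    (forall x y, B x -> B y -> k x = k y -> x = y) ->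
    (forall x, x \in s -> B x) -> (forall x, x \in t -> B x) ->
    map k s = map k t -> s = t.
  move=> kinj; elim: s t => [|x s IH] [|y t] //= sB tB [exy est].
  congr (_ :: _).
    by apply: kinj => //; [apply: sB|apply: tB]; exact: mem_head.
  apply: IH => // z zs; first by apply: sB; rewrite inE zs orbT.
  by apply: tB; rewrite inE zs orbT.
(* An injection of [A] into its complement yields the disjoint copy excluded by [noext]; one in the
   other direction codes all of [X] in [A]. *)
have [f [[fun_f inj_f]|[fun_f inj_f]]] := injfun_total A (~` A).
  exfalso.
  have /choice[c cP] x : exists y, (f @` A) x -> A y /\ f y = x.
    have [[y Ay <-]|nx] := pselect ((f @` A) x); first by exists y.
    by exists x.
  have [|x y /cP[_ ex] /cP[_ ey] e|k [kA kinj]] := code (f @` A) c.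
  - by move=> x /cP[].
  - by rewrite -ex -ey e.
  have wk s : word (A `|` f @` A) s -> word A (map k s).
    move=> [s0 ws]; split=> [|x /mapP[y /ws /kA ? ->]//].
    by case: s s0 {ws}.
  apply: (noext (f @` A) (fun s => f (phi (map k s)))).
  - by move=> x Ax [y /fun_f nA e]; apply: nA; rewrite e.
  - by exists (f a0), a0.
  - by move=> s /wk/phiA ?; exists (phi (map k s)).
  - move=> s s' ws ws' /inj_f e; apply: (inj_map _ _ _ _ kinj).
    + by case: ws.
    + by case: ws'.
    + apply: phi_inj; [exact: wk|exact: wk|].
      by apply: e; apply/mem_set/phiA/wk.
have [||k [kA kinj]] := code (~` A) f.
- by move=> x /fun_f.
- by move=> x y nx ny; apply: inj_f; exact/mem_set.
have wk s : word A (a0 :: map k s).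
  split=> // x; rewrite inE => /orP[/eqP ->//|/mapP[y _ ->]].
  by apply: kA; rewrite setUv.
(* The leading [a0] is there for the empty word, on which [phi] is not controlled. *)
exists (fun s => phi (a0 :: map k s)) => s s' /(phi_inj _ _ (wk s) (wk s')).
by case; apply: (inj_map _ _ _ _ kinj) => x _; rewrite setUv.
Qed.

Lemma card_lt_le_trans (T U V : Type) (A : set T) (B : set U) (C : set V) :
  A #<= B -> card_lt B C -> card_lt A C.
Proof.
move=> AB [BC nCB]; split; first exact: card_le_trans BC.
by move=> CA; apply: nCB; exact: card_le_trans AB.
Qed.

Lemma card_lt_uncountable (T U : Type) (A : set T) (B : set U) :
  ~ countable B -> countable A -> card_lt A B.
Proof.
move=> ncB cA; have infB : infinite_set B by move=> /finite_set_countable.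
split; first by apply: card_le_trans (proj1 (infiniteP _) infB).
by move=> BA; apply: ncB; exact: card_le_trans cA.
Qed.

Lemma card_le_inj (T U : Type) (f : T -> U) :
  injective f -> [set: T] #<= [set: U].
Proof.
move=> finj; have e : f @` [set: T] #= [set: T].
  by apply: inj_card_eq => x y _ _; exact: finj.
by rewrite -(card_le_eql e); exact: card_leT.
Qed.

Lemma infinite_inj_nat (T : Type) : infinite_set [set: T] ->
  exists n : nat -> T, injective n.
Proof.
move/infiniteP/card_leP => -[f].
exists (fun k => val (f (SigSub (mem_set (I : [set: nat] k))))) => x y /val_inj.
by move=> /(@inj _ _ _ f) => /(_ (mem_set I) (mem_set I)) [].
Qed.

Section GeneratedGroups.
Local Open Scope ring_scope.

(** The flag [true] marks a minus sign. Such words serve to count a group by its generators. *)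
Definition signed_sum (G : zmodType) (S : set G) (w : seq (bool * S)) : G :=
  \sum_(u <- w) (if u.1 then - val u.2 else val u.2).

Lemma signed_sum_surj (G : zmodType) (S : set G) :
  smallest (@subgroup G) S = [set: G] ->
  forall x : G, exists w, signed_sum (S := S) w = x.
Proof.
move=> gen x.
suff : smallest (@subgroup G) S `<=` range (@signed_sum G S).
  by rewrite gen => /(_ x I)[w _ <-]; exists w.
apply: smallest_sub; last first.
  move=> s Ss; exists [:: (false, SigSub (mem_set Ss))] => //.
  by rewrite /signed_sum big_seq1.
split; first by exists [::]; rewrite // /signed_sum big_nil.
move=> _ _ [v _ <-] [w _ <-].
exists (v ++ [seq (~~ u.1, u.2) | u <- w]) => //.
rewrite /signed_sum big_cat big_map /= -sumrN; congr (_ + _).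
by apply: eq_bigr => -[[] s] _ //=; rewrite opprK.
Qed.

Lemma kappaAb_kappagAb (K : Type) (G : zmodType) : kappaAb K G -> kappagAb K G.
Proof.
by exists [set: G] => //; apply/seteqP; split=> // x _ H [_]; exact.
Qed.

(** The group is an image of the words on signed generators. These are countably many for finite
    [S], and no more than [S] for infinite [S] by [inj_seq_infinite]. *)
Lemma kappagAb_kappaAb (K : Type) (G : zmodType) :
  ~ countable [set: K] -> kappagAb K G -> kappaAb K G.
Proof.
move=> ncK [S ltS gen].
have leG : [set: G] #<= [set: seq (bool * S)].
  have -> : [set: G] = range (@signed_sum G S).
    apply/seteqP; split=> // x _.
    by have [w <-] := signed_sum_surj gen x; exists w.
  exact: card_image_le.
apply: card_lt_le_trans leG _.
have [finS|infS] := pselect (finite_set S).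
  apply: card_lt_uncountable => //.
  have [f finj] : exists f : S -> nat, injective f.
    have /pcard_leTP[f] : [set: S] #<= [set: nat].
      rewrite (card_le_eql (card_setT S)); exact: finite_set_countable.
    by exists f => x y; apply: inj; rewrite inE.
  apply: card_le_trans (countableP [set: seq (bool * nat)]).
  apply: (@card_le_inj _ _ (map (fun u => (u.1, f u.2)))).
  by apply: inj_map => -[b s] [b' s'] /= [-> /finj ->].
have infS' : infinite_set [set: S].
  by rewrite (eq_finite_set (card_setT S)).
have [n ninj] := infinite_inj_nat infS'.
have [f finj] := inj_seq_infinite ninj.
apply: card_lt_le_trans ltS.
rewrite -(card_le_eqr (card_setT S)).
(* A signed generator becomes the code of a two-letter word on [S] whose first letter, [n 0] or
   [n 1], records the sign. *)
pose h (w : seq (bool * S)) : seq S :=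
  [seq f [:: n (nat_of_bool u.1); u.2] | u <- w].
apply: (@card_le_inj _ _ (fun w => f (h w))) => v w /finj.
apply: inj_map => -[b s] [b' s'] /= /finj [/ninj] eb ->.
by case: b b' eb => [] [].
Qed.

End GeneratedGroups.

(** * Inverse systems of sets and free groups *)

Section Push.
Local Open Scope ring_scope.
Context (X Y : choiceType) (f : X -> Y).

Definition fgpush (D : {freeg X / int}) : {freeg Y / int} :=
  fglift (fun x => << f x >> : {freeg Y / int}) D.

Lemma fgpush_is_additive : zmod_morphism fgpush.
Proof. exact: lift_is_additive. Qed.

HB.instance Definition _ := GRing.isZmodMorphism.Build
  {freeg X / int} {freeg Y / int} fgpush fgpush_is_additive.

Lemma fgpushU k x : fgpush << k *g x >> = << k *g f x >>.
Proof.
rewrite /fgpush liftU; apply/eqP/freeg_eqP => y.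
by rewrite coeffZ !coeffU mul1r.
Qed.

Lemma fgpush_sum D : fgpush D = \sum_(x <- dom D) << coeff x D *g f x >>.
Proof.
rewrite -{1}(freeg_sumE D) raddf_sum /=.
by apply: eq_bigr => x _; exact: fgpushU.
Qed.

(** Coefficients of points with a common image may cancel, hence only an inclusion. *)
Lemma dom_fgpush D : {subset dom (fgpush D) <= map f (dom D)}.
Proof.
move=> y; rewrite fgpush_sum => /dom_sum_subset /flattenP[s /mapP[x + ->]].
rewrite mem_filter /= => xD; rewrite mem_dom coeffU.
by have [<- _|_] := eqVneq (f x) y; rewrite ?map_f // mulr0 eqxx.
Qed.

Lemma deg_fgpush D : deg (fgpush D) = deg D.
Proof.
rewrite fgpush_sum -[in RHS](freeg_sumE D) !raddf_sum.
by apply: eq_bigr => x _; rewrite /= !degU.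
Qed.

End Push.

Lemma fgpush_eq (X Y : choiceType) (f g : X -> Y) D : f =1 g ->
  fgpush f D = fgpush g D.
Proof. by move=> /funext ->. Qed.

Lemma fgpush_id (X : choiceType) (D : {freeg X / int}) : fgpush id D = D.
Proof. by rewrite fgpush_sum freeg_sumE. Qed.

Lemma fgpush_comp (X Y Z : choiceType) (f : Y -> Z) (g : X -> Y) D :
  fgpush (f \o g) D = fgpush f (fgpush g D).
Proof.
rewrite (fgpush_sum g) raddf_sum fgpush_sum.
by apply: eq_bigr => x _; rewrite /= fgpushU.
Qed.

Lemma freeg_generated (X : choiceType) :
  smallest (@subgroup {freeg X / int}) (range (fun x : X => << x >>)) = setT.
Proof.
apply/seteqP; split=> // D _ H [[H0 HB] HX].
have HN x : H x -> H (- x)%R by move=> Hx; rewrite -[(- x)%R]add0r; exact: HB.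
have HD x y : H x -> H y -> H (x + y)%R.
  by move=> Hx Hy; rewrite -[y]opprK; apply: HB => //; exact: HN.
rewrite -(freeg_sumE D); elim/big_ind: _ => // x _.
have -> : (<< coeff x D *g x >> = << x >> *~ coeff x D :> {freeg X / int})%R.
  by rewrite freegU_mulz intz.
have Hx : H << x >> by apply: HX; exists x.
elim: (coeff x D) => [|n IH|n IH]; rewrite ?mulr0z ?mulrSz //.
  by rewrite intS mulrzDr; auto.
by rewrite intS opprD mulrzDr mulrNz mulr1z; auto.
Qed.

Record set_invsys (d : Order.disp_t) (K : orderType d) := SetInvsys {
  sobj :> K -> choiceType;
  sbond : forall eta xi : K, (eta <= xi)%O -> sobj xi -> sobj eta;
  sbond_id : forall (xi : K) (h : (xi <= xi)%O) (x : sobj xi), sbond h x = x;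
  sbond_comp : forall (eta xi zeta : K) (h1 : (eta <= xi)%O)
    (h2 : (xi <= zeta)%O) (h3 : (eta <= zeta)%O) (x : sobj zeta),
    sbond h3 x = sbond h1 (sbond h2 x) }.

Definition thread (d : Order.disp_t) (K : orderType d) (X : set_invsys K)
    (t : forall xi, X xi) :=
  forall (eta xi : K) (h : (eta <= xi)%O), sbond h (t xi) = t eta.

Section SetSystems.
Context (d : Order.disp_t) (K : orderType d).
Implicit Types (X : set_invsys K).

Definition free_system X : inv_system K :=
  @InvSystem d K (fun xi => {freeg (X xi) / int})
    (fun eta xi h => fgpush (sbond (s := X) h))
    (fun xi h D => etrans (fgpush_eq D (sbond_id h)) (fgpush_id D))
    (fun eta xi zeta h1 h2 h3 D =>
       etrans (fgpush_eq D (sbond_comp h1 h2 h3)) (fgpush_comp _ _ D)).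

Definition free_system_deg X : inv_mor (free_system X) (Delta K int) :=
  @InvMor d K (free_system X) (Delta K int) (fun xi => @deg (X xi))
    (fun eta xi h D => deg_fgpush (sbond h) D).

Lemma projective_support X :
  projective_in (kappagAb K) (Delta K int) ->
  (forall xi, card_lt [set: X xi] [set: K]) -> (forall xi, inhabited (X xi)) ->
  exists S : forall xi, seq (X xi),
    [/\ forall xi, S xi <> [::], forall xi, uniq (S xi)
      & forall (eta xi : K) (h : (eta <= xi)%O),
          {subset S eta <= map (sbond h) (S xi)}].
Proof.
move=> proj ltX X0.
have [||s sP] := proj (free_system X) _ (free_system_deg X).
- move=> xi; exists (range (fun x : X xi => << x >>)).
    by apply: card_lt_le_trans (ltX xi); exact: card_image_le.
  exact: freeg_generated.
(* The degree is onto at each index, since [n] times a point has degree [n]. *)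
- move=> Z _ g h gh xi n; have [x] := X0 xi.
  by have := gh xi << n *g x >>; rewrite /= degU.
exists (fun xi => dom (s xi 1%R)); split.
- move=> xi /eqP; rewrite dom_eq0 => /eqP e.
  by have := sP xi 1%R; rewrite e raddf0.
- by move=> xi; exact: uniq_dom.
(* The bonding maps of the constant system fix 1, so the value at [eta] is the push of the value at
   [xi]. *)
- move=> eta xi h x; rewrite -[1%R]/(bond (Delta K int) h 1%R) mor_bond.
  exact: dom_fgpush.
Qed.

(** Along an ultrafilter containing all final segments of [K], the images of the [y zeta] in
    [X eta], eventually in a finite list, have a limit. *)
Lemma ultrafilter_thread X (y : forall xi, X xi) (k0 : K) :
  (forall eta, exists (zeta0 : K) (s : seq (X eta)),
     forall (zeta : K) (h : (eta <= zeta)%O), (zeta0 <= zeta)%O ->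
       sbond h (y zeta) \in s) ->
  exists t, @thread d K X t.
Proof.
move=> fin.
pose F : set (set K) :=
  [set A | exists zeta0, forall zeta, (zeta0 <= zeta)%O -> A zeta].
have FF : ProperFilter F.
  apply: Build_ProperFilter_ex; last split.
  - by move=> A [z Az]; exists z; exact: Az.
  - by exists k0.
  - move=> A B [u Au] [v Bv]; exists (Order.max u v) => z.
    by rewrite ge_max => /andP[/Au ? /Bv].
  - by move=> A B AB [u Au]; exists u => z /Au /AB.
have [U [UU FU]] := ultraFilterLemma FF.
have pigeon (I : eqType) (s : seq I) (A : I -> set K) :
    U [set z | exists2 i, i \in s & A i z] -> exists i, U (A i).
  elim: s => [|i s IH] Us.
    by have [z [j]] := filter_ex Us; rewrite in_nil.
  have [UA|UnA] := in_ultra_setVsetC (A i) UU; first by exists i.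
  apply: IH; apply: filterS (filterI Us UnA) => z [[j]].
  by rewrite inE => /orP[/eqP -> //|js Aj _]; exists j.
have lim eta : exists x : X eta,
    U [set zeta | exists h : (eta <= zeta)%O, sbond h (y zeta) = x].
  have [zeta0 [s sP]] := fin eta; apply: (pigeon _ s); apply: FU.
  exists (Order.max eta zeta0) => z; rewrite ge_max => /andP[h /(sP _ h) ys].
  by exists (sbond h (y z)) => //; exists h.
exists (fun eta => sval (cid (lim eta))) => eta xi h.
case: cid => u Uu; case: cid => v Uv /=.
(* Both limits are attained at a common index, as images of the same point. *)
have [z [[h1 <-] [h2 <-]]] := filter_ex (filterI Uu Uv).
by rewrite (sbond_comp h h1 h2).
Qed.

Lemma projective_thread X :
  infinite_cardinal K -> projective_in (kappagAb K) (Delta K int) ->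
  (forall xi, card_lt [set: X xi] [set: K]) -> (forall xi, inhabited (X xi)) ->
  exists t, @thread d K X t.
Proof.
move=> [_ infK _] proj ltX X0.
have [k0 _] := infinite_setN0 infK.
have [S [S0 Su Ssub]] := projective_support proj ltX X0.
have Smono eta xi (h : (eta <= xi)%O) : size (S eta) <= size (S xi).
  by rewrite -(size_map (sbond h)); apply: uniq_leq_size => //; exact: Ssub.
have [[N Nbd]|/forallNP unbd] :=
    pselect (exists N, forall xi, size (S xi) <= N).
  (* Sizes do not decrease with the index, so they are constant from an index [xi0] of maximal size
     on. *)
  have /(@ex_maxnP)-/(_ N) [|n /asboolP[xi0 <-] nmax] :
      exists n, `[< exists xi, size (S xi) = n >].
  - by exists (size (S k0)); apply/asboolP; exists k0.
  - by move=> n /asboolP[xi <-].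
  (* [S eta] has no repetitions and is at least as long as the image list that contains it, so both
     have the same elements. *)
  have Simg eta xi (h : (eta <= xi)%O) : (xi0 <= eta)%O ->
      {subset map (sbond h) (S xi) <= S eta}.
    move=> h0 x; have [|_ ->//] := uniq_min_size (Su eta) (Ssub _ _ h).
    rewrite size_map (leq_trans _ (Smono _ _ h0)) //.
    by apply: nmax; apply/asboolP; exists xi.
  have y xi : {x : X xi | x \in S xi}.
    by apply: cid; case: (S xi) (S0 xi) => // x s _; exists x; rewrite mem_head.
  apply: (@ultrafilter_thread _ (fun xi => sval (y xi)) k0) => eta.
  (* The points chosen beyond [zeta0] all map into the finite [S zeta0], hence into its image in
     [X eta]. *)
  pose zeta0 := Order.max eta xi0.
  have h0 : (eta <= zeta0)%O by rewrite le_max lexx.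
  exists zeta0, (map (sbond h0) (S zeta0)) => zeta h h1.
  rewrite (sbond_comp h0 h1 h) map_f //; apply: (Simg _ _ h1).
    by rewrite le_max lexx orbT.
  by rewrite map_f //; case: (y zeta).
have [cK|ncK] := pselect (countable [set: K]).
  have finX xi : finite_set [set: X xi].
    apply: contrapT => /infiniteP infX; case: (ltX xi) => _; apply.
    exact: card_le_trans cK infX.
  have y xi : X xi by apply: (sval (cid _)) => //; case: (X0 xi) => x; exists x.
  apply: (@ultrafilter_thread _ y k0) => eta; exists k0.
  have /finite_seqP[s es] := finX eta; exists s => zeta h _.
  by have : [set` s] (sbond h (y zeta)) by rewrite -es.
exfalso.
have /choice[a aP] n : exists xi, n < size (S xi).
  by have /existsNP[xi /negP] := unbd n; rewrite -ltnNge; exists xi.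
have acof xi : exists n, (xi < a n)%O.
  (* For this [n] the support at [a n] is larger than that at [xi], so monotonicity rules out
     [a n <= xi]. *)
  exists (size (S xi)); rewrite ltNge; apply/negP => /Smono.
  by rewrite leqNgt aP.
(* These sets are nonempty because [a] is cofinal, and countable, hence smaller than the uncountable
   [K]. *)
pose L xi : choiceType := {n : nat | (xi <= a n)%O}.
pose incl eta xi (h : (eta <= xi)%O) (n : L xi) : L eta :=
  exist _ (val n) (le_trans h (valP n)).
have incl_id xi (h : (xi <= xi)%O) (n : L xi) : incl _ _ h n = n.
  exact: val_inj.
have incl_comp eta xi zeta (h1 : (eta <= xi)%O) (h2 : (xi <= zeta)%O)
    (h3 : (eta <= zeta)%O) (n : L zeta) :
    incl _ _ h3 n = incl _ _ h1 (incl _ _ h2 n).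
  exact: val_inj.
pose Y := SetInvsys incl_id incl_comp.
have [||R [R0 _ Rsub]] := @projective_support Y proj.
- move=> xi; apply: card_lt_uncountable => //; exact: countableP.
- by move=> xi; have [n /ltW an] := acof xi; constructor; exists n.
(* An element [n] of [R k0] comes from every later [R xi], so [a n] would bound all indices, against
   [acof]. *)
have [n nR] : exists n, n \in R k0.
  by case: (R k0) (R0 k0) => // n s _; exists n; rewrite mem_head.
have [m anm] := acof (a (val (n : L k0))).
pose xi := Order.max k0 (a m).
have h : (k0 <= xi)%O by rewrite le_max lexx.
have /mapP[u _ eu] := Rsub _ _ h _ nR.
have := valP (u : L xi); rewrite ge_max => /andP[_].
have -> : val (u : L xi) = val (n : L k0) by rewrite eu.
by rewrite leNgt anm.
Qed.

End SetSystems.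

(** * Trees and threads *)

Section TreeLevels.
Context (d : Order.disp_t) (K : orderType d).
Context (d' : Order.disp_t) (T : porderType d').
Hypothesis tT : is_tree T.

Lemma tree_comparable (x y z : T) :
  (y <= x)%O -> (z <= x)%O -> (y >=< z)%O.
Proof.
rewrite le_eqVlt => /orP[/eqP -> zx|yx]; first exact: ge_comparable.
rewrite le_eqVlt => /orP[/eqP ->|zx]; first by rewrite lt_comparable.
have [|| m] := tT (x := x) (S := [set y; z]).
- by move=> _ [->|->].
- by exists y; left.
by case=> -> h; [apply: le_comparable|apply: ge_comparable]; apply: h;
  [right|left].
Qed.

(** Two isomorphisms of the predecessors onto initial segments have no least point of disagreement,
    so they agree and have the same image. *)
Lemma has_height_unique (x : T) (a b : K) :
  has_height x a -> has_height x b -> a = b.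
Proof.
move=> [f [ffun finj fsurj] flt] [g [gfun ginj gsurj] glt].
have agree (y : T) : (y < x)%O -> f y = g y.
  apply: contraPP => /eqP fgy yx.
  have [||m [/= mx fgm] mmin] :=
      tT (x := x) (S := [set y | (y < x)%O /\ f y != g y]).
  - by move=> z [].
  - by exists y.
  have below w : (w < x)%O -> (w < m)%O -> f w = g w.
    move=> wx wm; apply/eqP; apply: contraTT wm => fgw.
    by apply/negP => /lt_geF; rewrite mmin.
  (* If [f m < g m], then [g] takes the value [f m] at some [w] below [m]. There [f] and [g] agree,
     so [f w = f m], against injectivity. The other case is symmetric. *)
  case: (ltgtP (f m) (g m)) => fg; last by rewrite fg eqxx in fgm.
    have [|w /= wx gw] := gsurj (f m); first exact: lt_trans fg (gfun _ mx).
    have wm : (w < m)%O by rewrite -glt // gw.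
    have /finj : f w = f m by rewrite below.
    by rewrite !inE => /(_ wx mx) e; rewrite e ltxx in wm.
  have [|w /= wx fw] := fsurj (g m); first exact: lt_trans fg (ffun _ mx).
  have wm : (w < m)%O by rewrite -flt // fw.
  have /ginj : g w = g m by rewrite -below.
  by rewrite !inE => /(_ wx mx) e; rewrite e ltxx in wm.
case: (ltgtP a b) => // ab.
  have [y /= yx gy] := gsurj _ ab.
  by have := ffun _ yx; rewrite /= agree // gy ltxx.
have [y /= yx fy] := fsurj _ ab.
by have := gfun _ yx; rewrite /= -agree // fy ltxx.
Qed.

Lemma has_height_restrict (x y : T) (a : K) (f : T -> K) :
  set_bij [set y : T | (y < x)%O] [set b : K | (b < a)%O] f ->
  (forall y z : T, (y < x)%O -> (z < x)%O -> (f y < f z)%O = (y < z)%O) ->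
  (y < x)%O -> has_height y (f y).
Proof.
move=> [ffun finj fsurj] flt yx; exists f; last first.
  by move=> u v uy vy; apply: flt; exact: lt_trans yx.
split.
- by move=> z /= zy; rewrite flt //; exact: lt_trans yx.
- move=> u v; rewrite !inE /= => uy vy; apply: finj; rewrite inE /=.
    exact: lt_trans yx.
  exact: lt_trans yx.
- move=> c /= cb; have [z /= zx fz] := fsurj c (lt_trans cb (ffun _ yx)).
  by exists z => //=; rewrite -flt // fz.
Qed.

Lemma has_height_below (x : T) (a b : K) : has_height x a -> (b < a)%O ->
  exists2 y, (y < x)%O & has_height y b.
Proof.
move=> [f fbij flt] ba; have [_ _ /(_ _ ba)[y yx <-]] := fbij.
by exists y => //; exact: has_height_restrict fbij flt yx.
Qed.

Lemma has_height_lt (x y : T) (a : K) : has_height x a -> (y < x)%O ->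
  exists2 b, (b < a)%O & has_height y b.
Proof.
move=> [f fbij flt] yx; exists (f y); first by case: fbij => /(_ _ yx).
exact: has_height_restrict fbij flt yx.
Qed.

(** Of two distinct comparable elements the lower has the smaller height, and heights are unique. *)
Lemma level_comparable_eq (a : K) (x y : T) :
  level a x -> level a y -> (x >=< y)%O -> x = y.
Proof.
have lvl_lt (u v : T) : level a u -> level a v -> (u < v)%O -> False.
  move=> hu hv /(has_height_lt hv)[b ba /(has_height_unique hu) ab].
  by rewrite -ab ltxx in ba.
by move=> hx hy /comparable_ltgtP[/(lvl_lt _ _ hx hy)|/(lvl_lt _ _ hy hx)|].
Qed.

Lemma level_below (a b : K) (x : T) : level a x -> (b <= a)%O ->
  exists2 y, level b y & (y <= x)%O.
Proof.
move=> hx; rewrite le_eqVlt => /orP[/eqP ->|/(has_height_below hx)[y /ltW]].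
  by exists x.
by exists y.
Qed.

End TreeLevels.

Lemma thread_tree_property (d : Order.disp_t) (K : orderType d) :
  (forall X : set_invsys K, (forall xi, card_lt [set: X xi] [set: K]) ->
     (forall xi, inhabited (X xi)) -> exists t, @thread d K X t) ->
  tree_property K.
Proof.
move=> thr d' T [[tT [hgt lvl0] ltK]]; apply.
pose L xi : choiceType := @level d K d' T xi.
have below eta xi (h : (eta <= xi)%O) (x : L xi) :
    exists y : L eta, (val y <= val x)%O.
  have [y hy yx] := level_below (set_mem (valP x)) h.
  by exists (SigSub (mem_set hy)).
pose pr eta xi h x : L eta := sval (cid (below eta xi h x)).
have prP eta xi h (x : L xi) : (val (pr eta xi h x) <= val x)%O.
  by rewrite /pr; case: cid.
(* Uniqueness of the predecessor on a given level, from which the laws of an inverse system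
   follow. *)
have LE xi (x y : L xi) : (val x >=< val y)%O -> x = y.
  move=> xy; apply: val_inj.
  by apply: (level_comparable_eq tT _ _ xy); exact: set_mem (valP _).
have pr_id xi (h : (xi <= xi)%O) (x : L xi) : pr _ _ h x = x.
  by apply: LE; apply: le_comparable; exact: prP.
have pr_comp eta xi zeta (h1 : (eta <= xi)%O) (h2 : (xi <= zeta)%O)
    (h3 : (eta <= zeta)%O) (x : L zeta) : pr _ _ h3 x = pr _ _ h1 (pr _ _ h2 x).
  apply: LE; apply: (tree_comparable tT (prP _ _ h3 x)).
  exact: le_trans (prP _ _ _ _) (prP _ _ _ _).
have [||t tP] := thr (SetInvsys pr_id pr_comp).
- move=> xi; apply: card_lt_le_trans (ltK xi).
  by rewrite (card_le_eql (card_setT _)).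
- by move=> xi; have [x hx] := lvl0 xi; constructor; exact: SigSub (mem_set hx).
have tle eta xi : (eta <= xi)%O -> (val (t eta : L eta) <= val (t xi : L xi))%O.
  by move=> h; rewrite -(tP _ _ h); exact: prP.
exists (range (fun xi => val (t xi : L xi))); split; first split.
- move=> _ _ [u _ <-] [v _ <-]; case: (leP u v) => [/tle|/ltW/tle] uv.
    exact: le_comparable.
  exact: ge_comparable.
(* The thread is a maximal chain: an element [y] of a larger chain is comparable with the member of
   the thread on its own level. *)
- move=> c cch bc; apply/seteqP; split=> // y cy.
  have [a hy] := hgt y; exists a => //.
  apply: (@level_comparable_eq d K _ _ tT a) => //.
    exact: set_mem (valP (t a : L a)).
  by apply: cch => //; apply: bc; exists a.
- move=> a; exists (val (t a : L a)); split; first by exists a.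
  exact: set_mem (valP (t a : L a)).
Qed.

(** A separate name for the disjoint union, to carry the tree order [sys_le]. *)
Definition sys_tree (d : Order.disp_t) (K : orderType d) (X : set_invsys K) :=
  {xi : K & X xi}.

Section SystemTree.
Context (d : Order.disp_t) (K : orderType d) (X : set_invsys K).
Local Notation T := (sys_tree X).

HB.instance Definition _ := Choice.on T.

Definition sys_le (p q : T) : bool :=
  `[< exists h : (tag p <= tag q)%O, sbond h (tagged q) = tagged p >].

Lemma sys_le_tag p q : sys_le p q -> (tag p <= tag q)%O.
Proof. by move=> /asboolP[]. Qed.

Lemma sys_le_eq p q : sys_le p q -> tag p = tag q -> p = q.
Proof.
case: p q => [a x] [b y] /asboolP[/= h +] ab; case: b / ab y h => y h.
by rewrite sbond_id => ->.
Qed.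

Lemma sys_le_refl : reflexive sys_le.
Proof. by move=> p; apply/asboolP; exists (lexx _); rewrite sbond_id. Qed.

Lemma sys_le_anti : antisymmetric sys_le.
Proof.
move=> p q /andP[pq qp]; apply: sys_le_eq => //.
by apply/le_anti; rewrite !sys_le_tag.
Qed.

Lemma sys_le_trans : transitive sys_le.
Proof.
move=> q p r /asboolP[h1 e1] /asboolP[h2 e2]; apply/asboolP.
by exists (le_trans h1 h2); rewrite (sbond_comp h1 h2) e2.
Qed.

HB.instance Definition _ := Order.Le_isPOrder.Build d T
  sys_le_refl sys_le_anti sys_le_trans.

Lemma sys_lt_tag (p q : T) : (p < q)%O -> (tag p < tag q)%O.
Proof.
rewrite !lt_neqAle => /andP[pq le]; rewrite (sys_le_tag le) andbT.
by apply: contra pq => /eqP /(sys_le_eq le) ->.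
Qed.

(** Both are images of [r], and the map from [r] to the lower index factors through the higher
    one. *)
Lemma sys_le_below (p q r : T) :
  (p <= r)%O -> (q <= r)%O -> (tag p <= tag q)%O -> (p <= q)%O.
Proof.
move=> /asboolP[h1 e1] /asboolP[h2 e2] h; apply/asboolP; exists h.
by rewrite -e2 -(sbond_comp h h2 h1).
Qed.

Lemma sys_lt_below (p q r : T) :
  (p <= r)%O -> (q <= r)%O -> (tag p < tag q)%O = (p < q)%O.
Proof.
move=> pr qr; apply/idP/idP => [pq|]; last exact: sys_lt_tag.
rewrite lt_neqAle (sys_le_below pr qr (ltW pq)) andbT.
by apply: contraTneq pq => ->; rewrite ltxx.
Qed.

(** The isomorphism is [tag] itself: the predecessor of [q] over an index [b] is the image of [q]
    there. *)
Lemma sys_has_height (q : T) : has_height q (tag q).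
Proof.
exists tag; last by move=> y z /ltW yq /ltW zq; exact: sys_lt_below yq zq.
split.
- by move=> p; exact: sys_lt_tag.
- move=> y z; rewrite !inE /= => /ltW yq /ltW zq e; apply: sys_le_eq => //.
  by apply: (sys_le_below yq zq); rewrite e.
- move=> b /= bq; exists (existT _ b (sbond (ltW bq) (tagged q))) => //=.
  by rewrite -(sys_lt_below (r := q)) //; apply/asboolP; exists (ltW bq).
Qed.

Lemma sys_is_tree : well_ordered [set: K] -> is_tree T.
Proof.
move=> wK q S Sq [p0 Sp0].
have [//||a [p Sp <-] amin] := wK (tag @` S).
  by exists (tag p0), p0.
exists p => // y Sy; apply: (@sys_le_below _ _ q).
- exact/ltW/Sq.
- exact/ltW/Sq.
- by apply: amin; exists y.
Qed.

Lemma sys_levelE : well_ordered [set: K] ->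
  forall a, level a = range (fun x : X a => existT _ a x : T).
Proof.
move=> wK a; apply/seteqP; split=> [q hq|_ [x _ <-]].
  rewrite -(has_height_unique (sys_is_tree wK) (sys_has_height q) hq).
  by exists (tagged q) => //; case: q {hq}.
exact: sys_has_height.
Qed.

Lemma tree_property_thread : well_ordered [set: K] -> tree_property K ->
  (forall xi, card_lt [set: X xi] [set: K]) -> (forall xi, inhabited (X xi)) ->
  exists t, @thread d K X t.
Proof.
move=> wK tpK ltX X0.
have [b [[bch _] bcof]] : exists b, cofinal_branch K (b : set T).
  apply: contrapT => nob; apply: (tpK _ T); split=> //; split.
  - exact: sys_is_tree.
  - split=> [q|a]; first by exists (tag q); exact: sys_has_height.
    by have [x] := X0 a; exists (existT _ a x); exact: sys_has_height.
  - move=> a; apply: card_lt_le_trans (ltX a); rewrite sys_levelE //.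
    exact: card_image_le.
have tex a : exists x : X a, b (existT _ a x : T).
  have [q [bq]] := bcof a; rewrite sys_levelE // => -[x _ e].
  by exists x; rewrite e.
exists (fun a => sval (cid (tex a))) => eta xi h.
case: cid => u bu; case: cid => v bv /=.
(* In the first case the order goes against [h], so the two indices coincide. *)
have /orP[|] := bch _ _ bu bv => /asboolP[/= h'].
  have e : eta = xi by apply/le_anti/andP.
  by case: xi / e h h' u bu => h h' u bu; rewrite !sbond_id.
by rewrite (bool_irrelevance h' h).
Qed.

End SystemTree.

(** * Projectivity *)

Section Projectivity.
Context (d : Order.disp_t) (K : orderType d).
Local Open Scope ring_scope.

(** The image is a proper subgroup of the integers; if it is nonzero, its least positive element
    generates it. *)
Lemma additive_int_cokernel (G : zmodType) (f : {additive G -> int}) :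
  (forall x, f x <> 1) ->
  exists2 p : nat, (1 < p)%N & forall x, (p%:Z %| f x)%Z.
Proof.
move=> f1.
have [ex|nex] := pselect (exists n, `[< (0 < n)%N /\ exists x, f x = n%:Z >]).
  case: (ex_minnP ex) => p /asboolP[p0 [y fy]] pmin; exists p.
    by case: p p0 fy {pmin} => [|[]] // _ /f1.
  move=> x; apply/dvdz_mod0P/eqP; apply: contrapT => /negP r0.
  (* The remainder is again a value of [f], so it vanishes by minimality of [p]. *)
  have fr : f (x - y *~ (f x %/ p)%Z) = (f x %% p)%Z.
    by rewrite raddfB raddfMz fy -mulrzr /modz mulrC intz.
  have: (0 <= f x %% p)%Z by rewrite modz_ge0 // eqz_nat -lt0n.
  have: ((f x %% p)%Z < p%:Z) by rewrite ltz_pmod.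
  case: (f x %% p)%Z r0 fr => // r r0 fr rp _.
  suff : (p <= r)%N by rewrite leqNgt -ltz_nat rp.
  apply: pmin; apply/asboolP; split; first by rewrite lt0n.
  by exists (x - y *~ (f x %/ p)%Z).
(* If [f] is zero, any modulus above 1 serves. *)
exists 2%N => // x; suff -> : f x = 0 by exact: dvdz0.
apply: contrapT => fx0; apply: nex; exists `|f x|%N; apply/asboolP; split.
  by rewrite absz_gt0; exact/eqP.
have [fx|fx] := leP 0 (f x); first by exists x; rewrite gez0_abs.
by exists (- x); rewrite raddfN ltz0_abs.
Qed.

Lemma kappaAb_finite (G : finZmodType) : infinite_set [set: K] -> kappaAb K G.
Proof.
move=> infK; have finG : finite_set [set: G] by exact: finite_finset.
split; last by move=> /card_le_finite /(_ finG).
apply: card_le_trans (proj1 (infiniteP _) infK); exact: finite_set_countable.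
Qed.

Lemma epi_onto_Delta_int (R : inv_system K) (e : inv_mor R (Delta K int)) :
  infinite_set [set: K] -> epi_in (kappaAb K) e ->
  forall xi, exists x, e xi x = 1.
Proof.
move=> infK epi xi0; apply: contrapT => /forallNP noone.
have [p p1 pdvd] := additive_int_cokernel noone.
(* Reduction mod p at the xi >= xi0 and zero below is nonzero and kills the
   image of e, since im e_xi is contained in im e_xi0 for xi >= xi0. *)
pose idZ : {additive 'Z_p -> 'Z_p} := idfun.
pose zeroZ : {additive 'Z_p -> 'Z_p} := \0.
(* The map is zero exactly when [eta < xi0 <= xi]. The identity below [xi0] keeps [b_id] true with
   the same group ['Z_p] at all indices. *)
pose b (eta xi : K) (h : (eta <= xi)%O) : {additive 'Z_p -> 'Z_p} :=
  if (xi0 <= eta)%O || ~~ (xi0 <= xi)%O then idZ else zeroZ.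
have b_id xi (h : (xi <= xi)%O) (x : 'Z_p) : b _ _ h x = x.
  by rewrite /b orbN.
have b_comp eta xi zeta (h1 : (eta <= xi)%O) (h2 : (xi <= zeta)%O)
    (h3 : (eta <= zeta)%O) (x : 'Z_p) : b _ _ h3 x = b _ _ h1 (b _ _ h2 x).
  rewrite /b; have [h|_] /= := boolP (xi0 <= eta)%O.
    by rewrite (le_trans h h1).
  have [h|_] /= := boolP (xi0 <= xi)%O; first by rewrite (le_trans h h2).
  by case: (xi0 <= zeta)%O.
pose Z := @InvSystem d K (fun=> 'Z_p) b b_id b_comp.
pose redp : {additive int -> 'Z_p} := intmul 1.
pose zerop : {additive int -> 'Z_p} := \0.
pose g xi : {additive int -> 'Z_p} :=
  if (xi0 <= xi)%O then redp else zerop.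
have g_bond eta xi (h : (eta <= xi)%O) (n : int) :
    g eta (bond (Delta K int) h n) = bond Z h (g xi n).
  rewrite /= /g /b; have [h0|_] /= := boolP (xi0 <= eta)%O.
    by rewrite (le_trans h0 h).
  by case: (xi0 <= xi)%O.
have zero_bond eta xi (h : (eta <= xi)%O) (n : int) :
    zerop (bond (Delta K int) h n) = bond Z h (zerop n).
  by rewrite raddf0.
have := epi Z (fun xi => kappaAb_finite _ infK)
  (@InvMor d K (Delta K int) Z g g_bond)
  (@InvMor d K (Delta K int) Z (fun=> zerop) zero_bond) _ xi0 1.
rewrite /= /g lexx => h; have {h} : (1 : 'Z_p) = 0.
  apply: h => xi x; have [h|//] := boolP (xi0 <= xi)%O.
  have -> : e xi x = e xi0 (bond R h x) by rewrite mor_bond.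
  have /dvdzP[k ->] := pdvd (bond R h x).
  by rewrite /= -mulrzA_C -[1 *~ p%:Z]/(p%:R) pchar_Zp // mul0rz.
by move/eqP; rewrite oner_eq0.
Qed.

Lemma tree_property_projective : infinite_cardinal K -> tree_property K ->
  projective_in (kappaAb K) (Delta K int).
Proof.
move=> [wK infK _] tpK R ltR e epi.
have surj := epi_onto_Delta_int infK epi.
pose L xi : choiceType := {x : R xi | e xi x == 1}.
have bondL eta xi (h : (eta <= xi)%O) (x : L xi) :
    e eta (bond R h (val x)) == 1.
  by rewrite mor_bond /= (valP x).
pose b eta xi h (x : L xi) : L eta :=
  exist (fun y => e eta y == 1) _ (bondL eta xi h x).
have b_id xi (h : (xi <= xi)%O) (x : L xi) : b _ _ h x = x.
  by apply: val_inj; exact: bond_id.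
have b_comp eta xi zeta (h1 : (eta <= xi)%O) (h2 : (xi <= zeta)%O)
    (h3 : (eta <= zeta)%O) (x : L zeta) : b _ _ h3 x = b _ _ h1 (b _ _ h2 x).
  by apply: val_inj; exact: bond_comp.
have [||t tP] := @tree_property_thread d K (SetInvsys b_id b_comp) wK tpK.
(* A fibre is bounded by the whole group [R xi], so the cardinality of the group enters here, not
   the number of its generators. *)
- move=> xi; apply: card_lt_le_trans (ltR xi).
  by apply: (@card_le_inj _ _ val); exact: val_inj.
- by move=> xi; have [x /eqP ex] := surj xi; constructor; exists x.
pose s xi : {additive int -> R xi} := intmul (val (t xi : L xi)).
have s_bond eta xi (h : (eta <= xi)%O) (n : int) :
    s eta (bond (Delta K int) h n) = bond R h (s xi n).
  by rewrite /= raddfMz -(tP _ _ h).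
exists (@InvMor d K (Delta K int) R s s_bond) => xi n.
by rewrite /= raddfMz (eqP (valP (t xi : L xi))) intz.
Qed.

End Projectivity.

Theorem theorem2p7 (d : Order.disp_t) (K : orderType d)
    (hK : infinite_cardinal K) :
  [/\ projective_in (kappagAb K) (Delta K int) -> tree_property K,
      tree_property K -> projective_in (kappaAb K) (Delta K int)
    & ~ countable [set: K]%classic ->
      (tree_property K <-> projective_in (kappaAb K) (Delta K int))].
Proof.
have gen_tree : projective_in (kappagAb K) (Delta K int) -> tree_property K.
  by move=> proj; apply: thread_tree_property => X; exact: projective_thread.
have tree_proj := tree_property_projective hK.
split=> // ncK; split=> // proj; apply: gen_tree.
(* For uncountable kappa the two classes of groups coincide, so the converse reduces to
   [gen_tree]. *)
suff <- : kappaAb K = kappagAb K by [].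
apply/funext => G; apply/propext; split; first exact: kappaAb_kappagAb.
exact: kappagAb_kappaAb.
Qed.
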